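(* Let $L=(L,* )$ be a completely distributive lattice with an operation ${*}:L\times L\to L$ that makes it a unital quantale whose two-sided unit is the top element $1$. All continuous semilattices with bottom elements (as objects) and all pseudo-invertible $L$-ambiguous representations (as arrows), with the composition $R\overset{*}{,}Q$, form a category $\mathcal{S}em\mathcal{PR}^*_L$. This category contains $\mathcal{S}em\mathcal{PR}$ as a subcategory, via the embedding $I^*_L$ that preserves the objects and takes each pseudo-invertible ambiguous representation $R\subset S_1\times S_2$ to $$I^*_LR=\{(x,y,\alpha)\in S_1\times S_2\times L\mid (x,y)\in R\text{ or }\alpha=0\}.$$
   Context: Order-theoretic conventions. A subset $A$ of a poset is directed if for all $x,y\in A$ there is $z\in A$ with $x\le z$, $y\le z$; non-emptiness is not required, so the empty set is directed. A dcpo is a poset in which all directed subsets have suprema. One writes $x\ll y$ ($x$ is way below $y$) iff for every directed $D$ having a supremum, $y\le\sup D$ implies $x\le d$ for some $d\in D$ (so nothing is way below the least element). A continuous semilattice is a meet semilattice which is a dcpo and in which, for each $y$, the set $\{x\mid x\ll y\}$ is directed with supremum $y$. A subset of a dcpo is Scott closed if it is a lower set closed under suprema of its directed subsets; $\mathrm{Cl}(A)$ is the least Scott closed set containing $A$. A map between dcpos is Scott continuous iff it preserves suprema of directed sets. Crisp case. For continuous semilattices $S_1,S_2$ with zeros (bottom elements), an ambiguous representation of $S_1$ in $S_2$ is a binary relation $R\subset S_1\times S_2$ such that (a) if $(x,y)\in R$, $x\le x'$, $y'\le y$, then $(x',y')\in R$; (b) for all $x\in S_1$ the set $xR=\{y\mid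 (x,y)\in R\}$ is non-empty and closed under directed suprema in $S_2$. It is pseudo-invertible if whenever $(x,y)\in R$ and $y'\ll y$, there is $x'\ll x$ with $(x',y')\in R$. $\mathcal{S}em\mathcal{PR}$ is the category of continuous semilattices with zeros and pseudo-invertible ambiguous representations, with composition $R{;}Q=\{(x,z)\mid z\in\mathrm{Cl}(xRQ)\}$, $xRQ=\{z\mid\exists y:\ (x,y)\in R,(y,z)\in Q\}$, and identities $E_S=\{(x,y)\in S\times S\mid y\le x\}$. $L$-fuzzy case. $L$ is a completely distributive lattice with bottom $0$ and top $1$ ($0\ne1$). An $L$-ambiguous representation of $S_1$ in $S_2$ is a ternary relation $R\subset S_1\times S_2\times L$ such that (a) if $(x,y,\alpha)\in R$, $x\le x'$, $y'\le y$, $\alpha'\le\alpha$, then $(x',y',\alpha')\in R$; (b) for all $x\in S_1$ the set $xR=\{(y,\alpha)\in S_2\times L\mid (x,y,\alpha)\in R\}$ is Scott closed in $S_2\times L$ and contains all elements $(0_2,\alpha)$ and $(y,0)$, where $0_2$ is the zero of $S_2$; (c) if $(x,y,\alpha)\in R$ and $(x,y,\beta)\in R$, then $(x,y,\alpha\lor\beta)\in R$. A compatibility for continuous semilattices $S,S'$ with zeros is a map $P:S\times S'\to\{0,1\}$ that is meet-preserving in each variable, Scott continuous, with $P(0,y)=P(x,0')=0$ for all $x,y$; it is separating if $P(x_1,\cdot)=P(x_2,\cdot)$ implies $x_1=x_2$ and $P(\cdot,y_1)=P(\cdot,y_2)$ implies $y_1=y_2$. One writes $xPy$ for $P(x,y)$.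 With separating compatibilities $P_i:S_i\times\hat S_i\to\{0,1\}$ fixed, for an $L$-ambiguous representation $R\subset S_1\times S_2\times L$ one puts $$R^{\smile}=\{(\hat y,\hat x,\alpha)\in\hat S_2\times\hat S_1\times L\mid\text{for all }\beta\ll\alpha\text{ and }x\in S_1\text{ with }xP_1\hat x=1\text{ there is }y\in S_2\text{ with }(x,y,\beta)\in R,\ yP_2\hat y=1\},$$ and $R^{\smile\smile}=(R^{\smile})^{\smile}\subset S_1\times S_2\times L$ is computed with the reverse compatibilities $(\hat x,x)\mapsto P_i(x,\hat x)$. $R$ is called pseudo-invertible if $R^{\smile\smile}=R$. The operation $*$ making $L$ a unital quantale is associative, distributes over arbitrary suprema in each variable, and has $1$ as two-sided unit; commutativity is not assumed. For $R\subset S_1\times S_2\times L$, $Q\subset S_2\times S_3\times L$ put $$R*Q=\{(x,z,\alpha)\in S_1\times S_3\times L\mid \alpha\le\sup\{\beta*\gamma\mid\exists y\in S_2:\ (x,y,\beta)\in R,\ (y,z,\gamma)\in Q\}\},$$ and let $R\overset{*}{,}Q\subset S_1\times S_3\times L$ be given by $x(R\overset{*}{,}Q)=\mathrm{Cl}(x(R*Q))$ for all $x\in S_1$, where $x(\cdot)$ denotes the cut $\{(z,\alpha)\mid(x,z,\alpha)\in\cdot\}$. Equivalently, $(x,z,\alpha)\in R\overset{*}{,}Q$ iff for all $z'\ll z$, $\alpha'\ll\alpha$ there are $n\in\mathbb{N}$, $y_i\in S_2$, $\beta_i,\gamma_i\in L$ ($1\le i\le n$) with $(x,y_i,\beta_i)\in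 R$, $(y_i,z',\gamma_i)\in Q$ and $\beta_1*\gamma_1\lor\dots\lor\beta_n*\gamma_n\ge\alpha'$.
   Formalization: The fixed separating compatibilities are also assumed to make each Ŝ the Lawson dual of S: every Scott open filter of S is {x | xPy} for some y in Ŝ. For merely separating compatibilities the embedding need not send arrows to arrows, so the claim is false. *)

(* Defs.v *)
From mathcomp Require Import all_boot all_order.
From mathcomp Require Import boolp classical_sets.

Set Implicit Arguments.
Unset Strict Implicit.
Unset Printing Implicit Defensive.

Import Order.TTheory.

Local Open Scope classical_set_scope.
Local Open Scope order_scope.

(* [supremums A s] means that s is the least upper bound of A.                *)

Section Domains.
Context {d : Order.disp_t} {T : porderType d}.
Implicit Types (A D : set T) (x y s : T).

(* The empty set counts as directed: dcpos have bottom elements, Scott closed *)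
(* sets contain them, and nothing is way below them.                          *)
Definition directed A : Prop :=
  forall x y, A x -> A y -> exists z, [/\ A z, x <= z & y <= z].

Definition dcpo : Prop :=
  forall D, directed D -> exists s, supremums D s.

Definition way_below x y : Prop :=
  forall D s, directed D -> supremums D s -> y <= s ->
    exists2 z, D z & x <= z.

Definition continuous_poset : Prop :=
  forall y, directed [set x | way_below x y] /\
            supremums [set x | way_below x y] y.

Definition closed_directed_sups A : Prop :=
  forall D s, D `<=` A -> directed D -> supremums D s -> A s.

Definition Scott_closed A : Prop :=
  (forall x y, A y -> x <= y -> A x) /\ closed_directed_sups A.

Definition Scott_open A : Prop := Scott_closed (~` A).

Definition Cl A : set T := smallest Scott_closed A.

End Domains.
Arguments dcpo {d} T.
Arguments continuous_poset {d} T.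

Definition Scott_continuous {d d' : Order.disp_t} {T : porderType d}
    {T' : porderType d'} (f : T -> T') : Prop :=
  forall D s, directed D -> supremums D s -> supremums (f @` D) (f s).

Record contSemilat : Type := ContSemilat {
  cs_disp : Order.disp_t;
  cs_sort :> bMeetSemilatticeType cs_disp;
  cs_dcpo : dcpo cs_sort;
  cs_continuous : continuous_poset cs_sort }.

Definition complete_lattice {d : Order.disp_t} (L : tbLatticeType d) : Prop :=
  forall A : set L, exists s, supremums A s.

Definition lsup {d : Order.disp_t} {L : tbLatticeType d} (A : set L) : L :=
  supremum \bot A.
Definition linf {d : Order.disp_t} {L : tbLatticeType d} (A : set L) : L :=
  infimum \top A.

Definition completely_distributive {d : Order.disp_t} (L : tbLatticeType d) :
    Prop :=
  complete_lattice L /\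
  forall (I : Type) (J : I -> Type) (a : forall i, J i -> L),
    linf [set lsup (range (a i)) | i in [set: I]] =
    lsup [set linf [set a i (f i) | i in [set: I]]
         | f in [set: forall i, J i]].

Definition unital_quantale {d : Order.disp_t} {L : tbLatticeType d}
    (mul : L -> L -> L) : Prop :=
  [/\ associative mul,
      forall (A : set L) b, mul (lsup A) b = lsup [set mul a b | a in A],
      forall a (B : set L), mul a (lsup B) = lsup [set mul a b | b in B] &
      left_id \top mul /\ right_id \top mul].

Section Compatibility.
Variables S S' : contSemilat.

(* {0,1} is [bool] with its order [false <= true].                            *)
Definition compatibility (P : S -> S' -> bool) : Prop :=
  [/\ forall x1 x2 y, P (x1 `&` x2) y = P x1 y && P x2 y,
      forall x y1 y2, P x (y1 `&` y2) = P x y1 && P x y2,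
      Scott_continuous (fun p : S *p S' => P p.1 p.2) &
      forall x y, P \bot y = false /\ P x \bot = false].

Definition separating (P : S -> S' -> bool) : Prop :=
  (forall x1 x2, P x1 =1 P x2 -> x1 = x2) /\
  (forall y1 y2, P^~ y1 =1 P^~ y2 -> y1 = y2).

Definition reverse (P : S -> S' -> bool) : S' -> S -> bool := fun y x => P x y.

(* P identifies S' with the Lawson dual of S, i.e. with the set of all Scott  *)
(* open filters of S ordered by inclusion.  The empty filter is allowed, and  *)
(* Scott open sets never contain the bottom element.                          *)
(* A separating compatibility need not have this property: let S = S' be the  *)
(* finite subsets of nat under reverse inclusion, with an extra bottom, and   *)
(* let P C A hold iff C and A are disjoint.  Then the principal filter of a   *)
(* finite set is Scott open but is not of the form [set x | P x y].           *)
Definition Lawson_dual (P : S -> S' -> bool) : Prop :=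
  forall F : set S, Scott_open F ->
    (forall x1 x2, F x1 -> F x2 -> F (x1 `&` x2)) ->
    exists y, F = [set x | P x y].

End Compatibility.

Section CrispRepresentations.

Definition arep (S1 S2 : contSemilat) : Type := S1 -> S2 -> Prop.

Definition ambiguous_rep {S1 S2 : contSemilat} (R : arep S1 S2) : Prop :=
  (forall x x' y y', R x y -> x <= x' -> y' <= y -> R x' y') /\
  (forall x, [set y | R x y] !=set0 /\ closed_directed_sups [set y | R x y]).

Definition pseudo_invertible {S1 S2 : contSemilat} (R : arep S1 S2) : Prop :=
  forall x y y', R x y -> way_below y' y ->
    exists2 x', way_below x' x & R x' y'.

Definition SemPR_arrow {S1 S2 : contSemilat} (R : arep S1 S2) : Prop :=
  ambiguous_rep R /\ pseudo_invertible R.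

Definition arep_comp {S1 S2 S3 : contSemilat}
    (R : arep S1 S2) (Q : arep S2 S3) : arep S1 S3 :=
  fun x z => Cl [set z' | exists2 y, R x y & Q y z'] z.

Definition arep_id (S : contSemilat) : arep S S := fun x y => y <= x.

End CrispRepresentations.

Section FuzzyRepresentations.
Context {d : Order.disp_t} (L : tbLatticeType d).

Definition Larep (S1 S2 : contSemilat) : Type := S1 -> S2 -> L -> Prop.

Definition cut {S1 S2 : contSemilat} (R : Larep S1 S2) (x : S1) :
    set (S2 *p L) :=
  [set p | R x p.1 p.2].

Definition L_ambiguous_rep {S1 S2 : contSemilat} (R : Larep S1 S2) : Prop :=
  [/\ forall x x' y y' a a',
        R x y a -> x <= x' -> y' <= y -> a' <= a -> R x' y' a',
      forall x, [/\ Scott_closed (cut R x),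
                    forall a, R x \bot a & forall y, R x y \bot] &
      forall x y a b, R x y a -> R x y b -> R x y (a `|` b)].

Definition smile {S1 S1' S2 S2' : contSemilat}
    (P1 : S1 -> S1' -> bool) (P2 : S2 -> S2' -> bool) (R : Larep S1 S2) :
    Larep S2' S1' :=
  fun y' x' a => forall b x, way_below b a -> P1 x x' ->
    exists2 y, R x y b & P2 y y'.

Definition L_pseudo_invertible {S1 S1' S2 S2' : contSemilat}
    (P1 : S1 -> S1' -> bool) (P2 : S2 -> S2' -> bool) (R : Larep S1 S2) : Prop :=
  smile (reverse P2) (reverse P1) (smile P1 P2 R) = R.

Definition SemPRL_arrow (hat : contSemilat -> contSemilat)
    (P : forall S : contSemilat, S -> hat S -> bool)
    {S1 S2 : contSemilat} (R : Larep S1 S2) : Prop :=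
  L_ambiguous_rep R /\ L_pseudo_invertible (@P S1) (@P S2) R.

Variable mul : L -> L -> L.

Definition Larep_mul {S1 S2 S3 : contSemilat}
    (R : Larep S1 S2) (Q : Larep S2 S3) : Larep S1 S3 :=
  fun x z a =>
    a <= lsup [set c | exists y b1 b2, [/\ R x y b1, Q y z b2 & c = mul b1 b2]].

Definition Larep_comp {S1 S2 S3 : contSemilat}
    (R : Larep S1 S2) (Q : Larep S2 S3) : Larep S1 S3 :=
  fun x z a => Cl (cut (Larep_mul R Q) x) (z, a).

Definition Larep_embed {S1 S2 : contSemilat} (R : arep S1 S2) : Larep S1 S2 :=
  fun x y a => R x y \/ a = \bot.

End FuzzyRepresentations.

(* The arrows A -> B are the elements of [Hom A B] that satisfy [arr]; [comp] *)
(* is in diagrammatic order.                                                  *)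
Definition is_category (Ob : Type) (Hom : Ob -> Ob -> Type)
    (arr : forall A B, Hom A B -> Prop)
    (comp : forall A B C, Hom A B -> Hom B C -> Hom A C)
    (idm : forall A, Hom A A) : Prop :=
  [/\ forall A, arr A A (idm A),
      forall A B C (f : Hom A B) (g : Hom B C),
        arr A B f -> arr B C g -> arr A C (comp A B C f g),
      forall A B C D (f : Hom A B) (g : Hom B C) (h : Hom C D),
        arr A B f -> arr B C g -> arr C D h ->
        comp A B D f (comp B C D g h) = comp A C D (comp A B C f g) h,
      forall A B (f : Hom A B), arr A B f -> comp A A B (idm A) f = f &
      forall A B (f : Hom A B), arr A B f -> comp A B B f (idm B) = f].

(* A faithful functor that is the identity on objects.                        *)
Definition is_subcategory_embedding (Ob : Type)
    (Hom1 : Ob -> Ob -> Type)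
    (arr1 : forall A B, Hom1 A B -> Prop)
    (comp1 : forall A B C, Hom1 A B -> Hom1 B C -> Hom1 A C)
    (idm1 : forall A, Hom1 A A)
    (Hom2 : Ob -> Ob -> Type)
    (arr2 : forall A B, Hom2 A B -> Prop)
    (comp2 : forall A B C, Hom2 A B -> Hom2 B C -> Hom2 A C)
    (idm2 : forall A, Hom2 A A)
    (F : forall A B, Hom1 A B -> Hom2 A B) : Prop :=
  [/\ forall A B (f : Hom1 A B), arr1 A B f -> arr2 A B (F A B f),
      forall A B (f g : Hom1 A B), arr1 A B f -> arr1 A B g ->
        F A B f = F A B g -> f = g,
      forall A, F A A (idm1 A) = idm2 A &
      forall A B C (f : Hom1 A B) (g : Hom1 B C), arr1 A B f -> arr1 B C g ->
        F A C (comp1 A B C f g) = comp2 A B C (F A B f) (F B C g)].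

(* Main.v *)
(* Write b ◁ a when every set whose supremum dominates a has an element above *)
(* b.  In a completely distributive L each a is the supremum of the b ◁ a and *)
(* ◁ interpolates.  By Lawson duality, x' ≪ x holds iff some y' in the dual   *)
(* satisfies x P y' and forces x' <= u whenever u P y'; hence the             *)
(* pseudo-invertible L-ambiguous representations are exactly the relations    *)
(* such that                                                                  *)
(*   R x y a  <->  for all y' ≪ y and a' ◁ a there is x' ≪ x with R x' y' a', *)
(* and for such R and Q (x, z, a) belongs to their composite iff for all      *)
(* z' ≪ z and a' ◁ a there are R x y b and Q y z' c with a' <= b * c, a       *)
(* single product instead of a finite join.  The category axioms are then     *)
(* interpolation arguments.  The crisp category embeds by I_L, which reflects *)
(* arrows and equality and preserves composition, so its axioms are inherited *)
(* from the fuzzy one.                                                        *)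
Require Import Defs.
From mathcomp Require Import all_boot all_order.
From mathcomp Require Import boolp classical_sets.

Set Implicit Arguments.
Unset Strict Implicit.
Unset Printing Implicit Defensive.

Import Order.TTheory.

Local Open Scope classical_set_scope.
Local Open Scope order_scope.

(** Arrows of the fuzzy category are defined through the duals; Lawson duality removes them.
    [SemPRL_arrowP] identifies arrows with [approximable] relations, trading [x' ≪ x] for a dual
    element ([Lawson_dual_between]) and back ([compatible_way_below]). On scalars, the relation ◁
    picks single products out of suprema: [Larep_compP] describes composites by one product at a
    time, and [totally_below_mul] splits an approximation of a product into approximations of its
    factors. Closure under composition, associativity and the unit laws then follow by interpolating
    ≪ and ◁. A crisp relation is an arrow exactly when its embedding is ([SemPR_arrowP],
    [Larep_embed_approximable]). Since the embedding is injective and multiplicative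
    ([Larep_embed_inj], [Larep_embed_comp]), the crisp closure, associativity and unit laws are
    pulled back along it. *)

Local Notation "x ≪ y" := (way_below x y) (at level 70, no associativity).

(** * Way-below relations *)

Section WayBelow.
Context {d : Order.disp_t} {T : porderType d}.
Implicit Types (x y z : T) (A D : set T).

Lemma supremums_le A s x : supremums A s -> A x -> x <= s.
Proof. by move=> [ub _]; apply: ub. Qed.

Lemma supremums_least A s t :
  supremums A s -> (forall x, A x -> x <= t) -> s <= t.
Proof. by move=> [_ lb] tA; apply: lb. Qed.

Lemma way_below_trans_le x y z : x ≪ y -> y <= z -> x ≪ z.
Proof. by move=> xy yz D s dD sD zs; apply: xy sD (le_trans yz zs). Qed.

Lemma le_way_below_trans x y z : x <= y -> y ≪ z -> x ≪ z.
Proof.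
move=> xy yz D s dD sD zs; have [w Dw yw] := yz D s dD sD zs.
by exists w => //; apply: le_trans yw.
Qed.

Hypothesis cT : continuous_poset T.

Lemma way_below_le x y : x ≪ y -> x <= y.
Proof. by move=> xy; have [_ sy] := cT y; apply: (supremums_le sy). Qed.

(** The elements two way-below steps under [z] still form a directed set with supremum [z]; testing
    [x ≪ z] on this set yields the interpolant. *)
Lemma way_below_interpolation x z : x ≪ z -> exists2 y, x ≪ y & y ≪ z.
Proof.
move=> xz; pose D := [set w | exists2 y, w ≪ y & y ≪ z].
have dD : directed D.
  move=> w1 w2 [y1 wy1 yz1] [y2 wy2 yz2].
  have [y [yz y1y y2y]] := (cT z).1 y1 y2 yz1 yz2.
  have [w [wy w1w w2w]] :=
    (cT y).1 w1 w2 (way_below_trans_le wy1 y1y) (way_below_trans_le wy2 y2y).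
  by exists w; split => //; exists y.
have sD : supremums D z.
  split=> [w [y wy yz]|t tD].
    exact: le_trans (way_below_le wy) (way_below_le yz).
  apply: (supremums_least (cT z).2) => y yz.
  by apply: (supremums_least (cT y).2) => w wy; apply: tD; exists y.
have [w [y wy yz] xw] := xz D z dD sD (lexx z).
by exists y => //; apply: le_way_below_trans wy.
Qed.

Lemma way_below_closed A :
  closed_directed_sups [set x | forall y, y ≪ x -> A y].
Proof.
move=> D s DA dD sD y ys.
have [z yz zs] := way_below_interpolation ys.
have [w Dw zw] := zs D s dD sD (lexx s).
exact: DA Dw _ (way_below_trans_le yz zw).
Qed.

(** In a continuous poset the closure of a lower set is reached in one step: adding all directed
    suprema once already gives a Scott closed set, by interpolation. *)
Lemma Cl_lowerP A :
  (forall x y, A y -> x <= y -> A x) ->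
  forall x, Cl A x <-> forall y, y ≪ x -> A y.
Proof.
move=> lA x; split; last first.
  move=> xA B [[lB cB] AB]; apply: cB (cT x).1 (cT x).2 => y /xA.
  exact: AB.
suff: Cl A `<=` [set z | forall y, y ≪ z -> A y] by apply.
apply: smallest_sub.
  split; last exact: way_below_closed.
  by move=> u v vA uv w wu; apply: vA; apply: way_below_trans_le uv.
by move=> u Au v vu; apply: lA Au (way_below_le vu).
Qed.

End WayBelow.

(** * Compatibilities and Lawson duality *)

Section CompatibleDuality.
Variables S S' : contSemilat.
Implicit Types (x : S) (y : S').

(* The filter generated by a chain x' ≪ ... ≪ x2 ≪ x1 ≪ x obtained by         *)
(* repeated interpolation.                                                    *)
Lemma open_filter_between x' x : x' ≪ x ->
  exists F : set S, [/\ Scott_open F,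
    forall u v, F u -> F v -> F (u `&` v),
    F x & forall u, F u -> x' <= u].
Proof.
move=> x'x.
have [f fP] : {f : S -> S & forall v, x' ≪ v -> x' ≪ f v /\ f v ≪ v}.
  apply: (@choice _ _ (fun v w => x' ≪ v -> x' ≪ w /\ w ≪ v)) => v.
  have [x'v|] := pselect (x' ≪ v); last by exists v.
  have [w] := way_below_interpolation (@cs_continuous S) x'v.
  by exists w.
pose c n := iter n f x.
have x'c n : x' ≪ c n by elim: n => [//|n /fP[]].
have cS n : c n.+1 ≪ c n by have [] := fP _ (x'c n).
have cD n m : c (n + m)%N <= c n.
  elim: m => [|m IH]; first by rewrite addn0.
  by rewrite addnS (le_trans _ IH) // (way_below_le (@cs_continuous S)).
exists [set u | exists n, c n <= u]; split.
- split=> [u v nv uv [n nu]|D s DF dD sD [n ns]].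
    by apply: nv; exists n; apply: le_trans uv.
  have [w Dw nw] := cS n D s dD sD ns.
  by apply: DF Dw _; exists n.+1.
- move=> u v [n nu] [m mv]; exists (n + m)%N.
  by rewrite lexI (le_trans (cD n m) nu) addnC (le_trans (cD m n) mv).
- by exists 0%N.
- by move=> u [n]; apply: le_trans; apply: way_below_le (@cs_continuous S) _ _ _.
Qed.

Variable P : S -> S' -> bool.

Lemma compatible_way_below x y' : compatibility P -> P x y' ->
  exists2 x', x' ≪ x & P x' y'.
Proof.
move=> [_ _ Pc P0] Pxy'; apply: contrapT => nx.
pose D := [set p : S *p S' | p.1 ≪ x /\ p.2 = y'].
have [cx sx] := @cs_continuous S x.
(* [D] must be non-empty to have supremum [(x, y')]; this holds because [P x y'] excludes
   [x = \bot]. *)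
have [u ux] : exists u, u ≪ x.
  apply: contrapT => nux; have : P \bot y' = false by have [] := P0 \bot y'.
  suff -> : \bot = x by rewrite Pxy'.
  apply/eqP; rewrite eq_le le0x; apply: (supremums_least sx) => u ux.
  by case: nux; exists u.
have dD : directed D.
  move=> [a1 b1] [a2 b2] [/= a1x ->] [/= a2x ->].
  have [a [ax a1a a2a]] := cx _ _ a1x a2x.
  exists (a, y'); split; first by split.
    by rewrite leEprod /= a1a lexx.
  by rewrite leEprod /= a2a lexx.
have sD : supremums D (x, y').
  split=> [[a b] [/= ax ->]|[a b] Dab].
    by rewrite leEprod /= lexx andbT; apply: (supremums_le sx).
  apply/andP; split => /=.
    apply: (supremums_least sx) => v vx.
    by have /andP[] := Dab (v, y') (conj vx erefl).
  by have /andP[] := Dab (u, y') (conj ux erefl).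
have /= sP := Pc D _ dD sD.
have : P x y' <= false.
  apply: (supremums_least sP) => _ [[a b] [/= ax ->] <- /=].
  by case Pa: (P a y') => //=; case: nx; exists a.
by rewrite Pxy'.
Qed.

Lemma Lawson_dual_between x' x : Lawson_dual P -> x' ≪ x ->
  exists2 y', P x y' & forall u, P u y' -> x' <= u.
Proof.
move=> dP /open_filter_between[F [oF mF Fx x'F]].
have [y' FE] := dP F oF mF.
by exists y' => [|u]; [move: Fx; rewrite FE|move: (x'F u); rewrite FE].
Qed.

End CompatibleDuality.

(** * The totally-below relation of a completely distributive lattice *)

Section TotallyBelow.
Context {d : Order.disp_t} {L : tbLatticeType d}.
Implicit Types (a b c : L) (A : set L).

(** Raney's relation: way below, tested on arbitrary sets instead of directed ones. *)
Definition totally_below a b := forall A, b <= lsup A -> exists2 c, A c & a <= c.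

Hypothesis hL : completely_distributive L.

Lemma lsupP A : supremums A (lsup A).
Proof.
rewrite /lsup /supremum; case: ifPn => [/eqP ->|_].
  by split=> [x []|x _]; rewrite ?le0x.
by apply: xgetPex; apply: hL.1.
Qed.

Lemma le_lsup A a : A a -> a <= lsup A.
Proof. exact: supremums_le (lsupP A). Qed.

Lemma lsup_le A b : (forall a, A a -> a <= b) -> lsup A <= b.
Proof. exact: supremums_least (lsupP A). Qed.

Lemma linfP A : infimums A (linf A).
Proof.
rewrite /linf /infimum; case: ifPn => [/eqP ->|_].
  by split=> [x []|x _]; rewrite ?lex1.
apply: xgetPex; exists (lsup (lbound A)); split.
  by move=> a Aa; apply: lsup_le => b; apply.
by move=> b; apply: le_lsup.
Qed.

Lemma linf_le A a : A a -> linf A <= a.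
Proof. by have [lb _] := linfP A; apply: lb. Qed.

Lemma le_linf A b : (forall a, A a -> b <= a) -> b <= linf A.
Proof. by have [_ ub] := linfP A; apply: ub. Qed.

Lemma totally_below_le a b : totally_below a b -> a <= b.
Proof.
by move=> /(_ [set b])[|c -> //]; apply: le_lsup.
Qed.

Lemma le_totally_below_trans a b c : a <= b -> totally_below b c ->
  totally_below a c.
Proof. by move=> ab bc A /bc[e Ae be]; exists e => //; apply: le_trans be. Qed.

Lemma totally_below_trans_le a b c : totally_below a b -> b <= c ->
  totally_below a c.
Proof. by move=> ab bc A /(le_trans bc) /ab. Qed.

Lemma totally_below_bot a : ~ totally_below a \bot.
Proof. by move=> /(_ set0)[|c []]; rewrite le0x. Qed.

(* Complete distributivity is applied to the family of all sets A with        *)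
(* b <= lsup A: the infimum of a choice from every A is totally below b.      *)
Lemma le_lsup_totally_below b : b <= lsup [set a | totally_below a b].
Proof.
pose I := {A : set L | b <= lsup A}; pose J (i : I) := {c | sval i c}.
have := hL.2 I J (fun i j => sval j); set l := linf _; set r := lsup _ => lr.
have bl : b <= l.
  apply: le_linf => _ [[A bA] _ <-]; apply: (le_trans bA).
  by apply: lsup_le => a Aa; apply: le_lsup; exists (exist _ a Aa).
apply: (le_trans bl); rewrite lr.
apply: lsup_le => _ [f _ <-]; apply: le_lsup => A bA.
exists (sval (f (exist _ A bA))); first exact: svalP (f (exist _ A bA)).
by apply: linf_le; exists (exist _ A bA).
Qed.

Lemma totally_below_lubP b c : (forall a, totally_below a b -> a <= c) -> b <= c.
Proof. by move=> bc; apply: le_trans (le_lsup_totally_below b) (lsup_le bc). Qed.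

Lemma totally_below_interpolation a b : totally_below a b ->
  exists2 c, totally_below a c & totally_below c b.
Proof.
move=> ab; have [|e [c ec cb] ae] :=
  ab [set e | exists2 c, totally_below e c & totally_below c b].
  apply: totally_below_lubP => c cb; apply: totally_below_lubP => e ec.
  by apply: le_lsup; exists c.
by exists c => //; apply: le_totally_below_trans ec.
Qed.

Lemma totally_below_way_below a b : totally_below a b -> a ≪ b.
Proof.
move=> ab D s _ sD bs; apply: ab; apply: le_trans bs _.
by apply: (supremums_least sD) => c; apply: le_lsup.
Qed.

(** Binary joins make the set of elements way below [b] directed, and it contains every [a ◁ b],
    whose supremum is already [b]. *)
Lemma cd_continuous : continuous_poset L.
Proof.
move=> b; split=> [a1 a2 a1b a2b|].
  exists (a1 `|` a2); split; rewrite ?leUl ?leUr // => D s dD sD bs.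
  have [c1 Dc1 ac1] := a1b D s dD sD bs; have [c2 Dc2 ac2] := a2b D s dD sD bs.
  have [c [Dc c1c c2c]] := dD _ _ Dc1 Dc2.
  by exists c => //; rewrite leUx (le_trans ac1) // (le_trans ac2).
split=> [a ab|c bc]; last first.
  by apply: totally_below_lubP => a /totally_below_way_below; apply: bc.
have [x y -> ->||//|c -> //] := ab [set b] b; first by exists b.
by rewrite supremums1.
Qed.

Lemma totally_below_nonbot a : a <> \bot ->
  exists2 b, b <> \bot & totally_below b a.
Proof.
move=> a0; apply: contrapT => nb; apply: a0; apply/eqP; rewrite eq_le le0x andbT.
apply: totally_below_lubP => b ba.
by have [->//|b0] := pselect (b = \bot); case: nb; exists b.
Qed.

End TotallyBelow.

Local Notation "a ◁ b" := (totally_below a b) (at level 70, no associativity).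

Lemma not_way_below_bot (S : contSemilat) (x : S) : ~ x ≪ \bot.
Proof.
move=> /(_ set0 \bot)[|||? //]; [by move=> ? ? []|split|exact: lexx].
- by move=> ? [].
- by move=> ? _; apply: le0x.
Qed.

(** * Rectangles and cuts *)

Section Products.
Context {d d' : Order.disp_t} {T : porderType d} {T' : porderType d'}.
Implicit Types (D : set (T *p T')).

Lemma supremums_fst D s : supremums D s -> supremums (fst @` D) s.1.
Proof.
case: s => [s1 s2] sD; split=> [_ [p Dp <-]|t tD].
  by have /andP[] := supremums_le sD Dp.
suff /(sD.2 (t, s2))/andP[] : ubound D (t, s2) by [].
move=> p Dp; have /andP[_ ps2] := supremums_le sD Dp.
by apply/andP; split => //; apply: tD; exists p.
Qed.

Lemma supremums_snd D s : supremums D s -> supremums (snd @` D) s.2.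
Proof.
case: s => [s1 s2] sD; split=> [_ [p Dp <-]|t tD].
  by have /andP[] := supremums_le sD Dp.
suff /(sD.2 (s1, t))/andP[] : ubound D (s1, t) by [].
move=> p Dp; have /andP[ps1 _] := supremums_le sD Dp.
by apply/andP; split => //; apply: tD; exists p.
Qed.

Lemma directed_fst D : directed D -> directed (fst @` D).
Proof.
move=> dD _ _ [p Dp <-] [q Dq <-].
have [r [Dr /andP[pr _] /andP[qr _]]] := dD _ _ Dp Dq.
by exists r.1; split => //; exists r.
Qed.

Lemma directed_snd D : directed D -> directed (snd @` D).
Proof.
move=> dD _ _ [p Dp <-] [q Dq <-].
have [r [Dr /andP[_ pr] /andP[_ qr]]] := dD _ _ Dp Dq.
by exists r.2; split => //; exists r.
Qed.

Lemma directed_setX1 (A : set T) b : directed A ->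
  directed [set p : T *p T' | A p.1 /\ p.2 = b].
Proof.
move=> dA [a1 _] [a2 _] [/= Aa1 ->] [/= Aa2 ->].
have [a [Aa a1a a2a]] := dA _ _ Aa1 Aa2.
exists (a, b); split; first by split.
  by rewrite leEprod /= a1a lexx.
by rewrite leEprod /= a2a lexx.
Qed.

Lemma supremums_setX1 (A : set T) b s : A !=set0 -> supremums A s ->
  supremums [set p : T *p T' | A p.1 /\ p.2 = b] (s, b).
Proof.
move=> [a0 Aa0] sA; split=> [[a _] [/= Aa ->]|[t c] tA].
  by rewrite leEprod /= lexx andbT; apply: supremums_le sA _.
apply/andP; split => /=; last first.
  by have /andP[] := tA (a0, b) (conj Aa0 erefl).
apply: (supremums_least sA) => a Aa.
by have /andP[] := tA (a, b) (conj Aa erefl).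
Qed.

Lemma directed_set1X a (B : set T') : directed B ->
  directed [set p : T *p T' | p.1 = a /\ B p.2].
Proof.
move=> dB [_ b1] [_ b2] [/= -> Bb1] [/= -> Bb2].
have [b [Bb b1b b2b]] := dB _ _ Bb1 Bb2.
exists (a, b); split; first by split.
  by rewrite leEprod /= b1b lexx.
by rewrite leEprod /= b2b lexx.
Qed.

Lemma supremums_set1X a (B : set T') s : B !=set0 -> supremums B s ->
  supremums [set p : T *p T' | p.1 = a /\ B p.2] (a, s).
Proof.
move=> [b0 Bb0] sB; split=> [[_ b] [/= -> Bb]|[c t] tB].
  by rewrite leEprod /= lexx; apply: supremums_le sB _.
apply/andP; split => /=; first by have /andP[] := tB (a, b0) (conj erefl Bb0).
apply: (supremums_least sB) => b Bb.
by have /andP[] := tB (a, b) (conj erefl Bb).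
Qed.

End Products.

Section Cuts.
Context {d : Order.disp_t} {L : tbLatticeType d} {S : contSemilat}.
Hypothesis hL : completely_distributive L.
Implicit Types (y : S) (a : L).

(** Interpolating in both coordinates, members of [D] exceed the two interpolants separately, and
    directedness merges them into one member. With [U] arbitrary, this supplies closed sets that
    bound [Cl] from above. *)
Lemma Scott_closed_approx (U : S -> L -> Prop) : Scott_closed
  [set p : S *p L | forall y a, y ≪ p.1 -> a ◁ p.2 -> U y a].
Proof.
split=> [[y a] [y' a'] /= U' /andP[/= yy' aa'] z b zy ba|].
  by apply: U'; [apply: way_below_trans_le yy'|apply: totally_below_trans_le aa'].
move=> D [s1 s2] DU dD sD y a /=.
move=> /(way_below_interpolation (@cs_continuous S))[y' yy' y's].
move=> /(totally_below_interpolation hL)[a' aa' a's].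
have [_ [p Dp <-] y'p] :=
  y's _ _ (directed_fst dD) (supremums_fst sD) (lexx _).
have [_ [q Dq <-] a'q] := totally_below_way_below hL a's
  (directed_snd dD) (supremums_snd sD) (lexx _).
have [r [Dr /andP[pr _] /andP[_ qr]]] := dD _ _ Dp Dq.
apply: DU Dr _ _ _ _.
  exact: way_below_trans_le yy' (le_trans y'p pr).
exact: totally_below_trans_le aa' (le_trans a'q qr).
Qed.

(** The hypothesis on [(\bot, a)] covers [y = \bot]: nothing is way below it, so no directed family
    would carry the scalar [a]. *)
Lemma Scott_closed_way_below (C : set (S *p L)) y a : Scott_closed C ->
  C (\bot, a) -> (forall y', y' ≪ y -> C (y', a)) -> C (y, a).
Proof.
move=> [_ cC] Ca Cy; have [[y' y'y]|ny] := pselect (exists y', y' ≪ y).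
  have [dy sy] := @cs_continuous S y.
  have y0 : [set z | z ≪ y] !=set0 by exists y'.
  apply: (cC _ _ _ (directed_setX1 (b := a) dy) (supremums_setX1 a y0 sy)).
  by move=> [z b] [/= zy ->]; apply: Cy.
suff -> : y = \bot by [].
apply/eqP; rewrite eq_le le0x andbT.
by apply: (supremums_least (@cs_continuous S y).2) => y' y'y; case: ny; exists y'.
Qed.

End Cuts.

(** * Pseudo-invertible representations *)

Section Approximation.
Context {d : Order.disp_t} {L : tbLatticeType d}.
Hypothesis hL : completely_distributive L.
Implicit Types S : contSemilat.

Definition approximable {S1 S2} (R : Larep L S1 S2) : Prop :=
  forall x y a, R x y a <->
    forall y' a', y' ≪ y -> a' ◁ a -> exists2 x', x' ≪ x & R x' y' a'.

Section ApproximableTheory.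
Variables (S1 S2 : contSemilat) (R : Larep L S1 S2).
Hypothesis aR : approximable R.

Lemma approximable_mono x x' y y' a a' :
  R x y a -> x <= x' -> y' <= y -> a' <= a -> R x' y' a'.
Proof.
move=> /aR Rxya xx' y'y a'a; apply/aR => z b zy' ba'.
have [||w wx Rw] := Rxya z b; first exact: way_below_trans_le y'y.
  exact: totally_below_trans_le a'a.
by exists w => //; apply: way_below_trans_le xx'.
Qed.

Lemma approximable_closed x y a :
  (forall y' a', y' ≪ y -> a' ◁ a -> R x y' a') -> R x y a.
Proof.
move=> Rx; apply/aR => y'' a'' /(way_below_interpolation (@cs_continuous S2)).
move=> [y' y''y' y'y] /(totally_below_interpolation hL)[a' a''a' a'a].
by have /aR := Rx _ _ y'y a'a; apply.
Qed.

Lemma approximable_botl x a : R x \bot a.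
Proof. by apply/aR => y' a' /not_way_below_bot. Qed.

Lemma approximable_botr x y : R x y \bot.
Proof. by apply/aR => y' a' _ /totally_below_bot. Qed.

Lemma approximable_L_ambiguous : L_ambiguous_rep R.
Proof.
split=> [|x|x y a b Ra Rb]; first exact: approximable_mono.
- split; [|exact: approximable_botl|exact: approximable_botr].
  have -> : cut R x = [set p : S2 *p L |
      forall y a, y ≪ p.1 -> a ◁ p.2 -> R x y a].
    apply/predeqP => -[y a]; split => /= [Rxya y' a' y'y a'a|].
      apply: approximable_mono Rxya _ _ _ => //.
        exact: way_below_le (@cs_continuous S2) _ _ _.
      exact: totally_below_le.
    exact: approximable_closed.
  exact: Scott_closed_approx.
- apply: approximable_closed => y' c y'y cab.
  have y'ley := way_below_le (@cs_continuous S2) y'y.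
  (* An element totally below a binary join lies below one of the two joinands. *)
  have [|e [->|->] ce] := cab [set a; b].
  + by rewrite leUx !le_lsup //; [right|left].
  + exact: approximable_mono Ra _ _ ce.
  + exact: approximable_mono Rb _ _ ce.
Qed.

End ApproximableTheory.

(** For fixed [y' ≪ y] the scalars [c] with [R x y' c] are closed under joins, hence directed, so
    Scott closedness admits their supremum, which dominates [a]. A second directed supremum passes
    from [y'] to [y]. *)
Lemma L_ambiguous_closed S1 S2 (R : Larep L S1 S2) : L_ambiguous_rep R ->
  forall x y a, (forall y' a', y' ≪ y -> a' ◁ a -> R x y' a') -> R x y a.
Proof.
move=> [mR cR jR] x y a Rx; have [sR R0 R1] := cR x.
apply: (Scott_closed_way_below (C := cut R x) sR); first exact: R0.
move=> y' y'y; pose B := [set c | R x y' c].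
have dB : directed B.
  move=> b c Rb Rc.
  by exists (b `|` c); rewrite leUl leUr; split => //; apply: jR.
have : cut R x (y', lsup B).
  have B0 : B !=set0 by exists \bot; apply: R1.
  apply: (sR.2 _ _ _ (directed_set1X (a := y') dB)
    (supremums_set1X y' B0 (lsupP hL B))).
  by move=> [_ b] [/= -> Rb].
move=> /(mR _ _ _ _ _ _) Rsup; apply: Rsup => //=.
apply: totally_below_lubP => // c ca; apply: le_lsup => //; exact: Rx.
Qed.

Section Arrows.
Variables (hat : contSemilat -> contSemilat).
Variables (P : forall S : contSemilat, S -> hat S -> bool).
Hypothesis hP : forall S, compatibility (@P S).
Hypothesis dP : forall S, Lawson_dual (@P S).

(** Duality replaces [y' ≪ y] by some [v]; the double [smile] answers with [u] related to [x], and
    compatibility lowers [x] to some [x' ≪ x] still related to [u]. Each [smile] costs one step ≪ on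
    scalars, hence the interpolant [b]. *)
Lemma L_pseudo_invertible_approx S1 S2 (R : Larep L S1 S2) x y a y' a' :
  L_ambiguous_rep R -> L_pseudo_invertible (@P S1) (@P S2) R ->
  R x y a -> y' ≪ y -> a' ≪ a -> exists2 x', x' ≪ x & R x' y' a'.
Proof.
move=> [mR _ _] iR; rewrite -{1}iR => Rxya y'y a'a.
have [b a'b ba] := way_below_interpolation (cd_continuous hL) a'a.
have [v yv vy'] := Lawson_dual_between (@dP S2) y'y.
have [u Rvu xu] := Rxya b v ba yv.
have [x' x'x x'u] := compatible_way_below (@hP S1) xu.
have [z Rz zv] := Rvu a' x' a'b x'u.
by exists x' => //; apply: mR Rz _ (vy' _ zv) _.
Qed.

Lemma approx_L_pseudo_invertible S1 S2 (R : Larep L S1 S2) :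
  L_ambiguous_rep R ->
  (forall x y a y' a', R x y a -> y' ≪ y -> a' ≪ a ->
    exists2 x', x' ≪ x & R x' y' a') ->
  L_pseudo_invertible (@P S1) (@P S2) R.
Proof.
move=> lR aR; have [mR _ _] := lR; apply/predeq3P => x y a; split => [Rxya|Rxya].
  apply: L_ambiguous_closed => // y' a' y'y /(totally_below_way_below hL) a'a.
  have [b a'b ba] := way_below_interpolation (cd_continuous hL) a'a.
  have [v yv vy'] := Lawson_dual_between (@dP S2) y'y.
  have [u Rvu xu] := Rxya b v ba yv.
  have [z Rz zv] := Rvu a' x a'b xu.
  by apply: mR Rz _ (vy' _ zv) _.
move=> b v ba yv; have [y' y'y y'v] := compatible_way_below (@hP S2) yv.
have [x' x'x Rx'] := aR _ _ _ _ _ Rxya y'y ba.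
(* This [u] is the required dual witness: everything related to it lies above [x'], where [R]
   already holds. *)
have [u xu ux'] := Lawson_dual_between (@dP S1) x'x.
exists u => // c z cb zu; exists y' => //.
by apply: mR Rx' (ux' _ zu) _ (way_below_le (cd_continuous hL) cb).
Qed.

(* The scalars a' for which some x' ≪ x satisfies R x' y' a' form a directed  *)
(* set, so it makes no difference whether a' ≪ a or a' ◁ a is required.       *)
Lemma SemPRL_arrowP S1 S2 (R : Larep L S1 S2) :
  SemPRL_arrow P R <-> approximable R.
Proof.
split=> [[lR iR] x y a|aR]; last first.
  have lR := approximable_L_ambiguous aR.
  split => //; apply: approx_L_pseudo_invertible => // x y a y' a' Rxya y'y a'a.
  pose D := [set c | exists2 x', x' ≪ x & R x' y' c].
  have dD : directed D.
    move=> c1 c2 [x1 x1x R1] [x2 x2x R2].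
    have [x' [x'x x1x' x2x']] := (@cs_continuous S1 x).1 _ _ x1x x2x.
    have [mR _ jR] := lR.
    exists (c1 `|` c2); rewrite leUl leUr; split => //; exists x' => //.
    by apply: jR; [apply: mR R1 _ _ _|apply: mR R2 _ _ _].
  have [|c [x' x'x Rx'] a'c] := a'a D _ dD (lsupP hL D).
    apply: totally_below_lubP => // c ca; apply: le_lsup => //.
    by move/aR : Rxya; apply.
  by exists x' => //; apply: approximable_mono Rx' _ _ a'c.
have [mR _ _] := lR.
split=> [Rxya y' a' y'y /(totally_below_way_below hL) a'a|Rxya].
  exact: L_pseudo_invertible_approx lR iR Rxya y'y a'a.
apply: L_ambiguous_closed => // y' a' y'y /(Rxya _ _ y'y)[x' x'x Rx'].
by apply: mR Rx' _ _ _ => //; apply: way_below_le (@cs_continuous S1) _ _ _.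
Qed.

End Arrows.

(** * Composition *)

Section Composition.
Variable mul : L -> L -> L.
Hypothesis hmul : unital_quantale mul.

Lemma mul_lub A B c : (forall a b, A a -> B b -> mul a b <= c) ->
  mul (lsup A) (lsup B) <= c.
Proof.
case: hmul => _ mull mulr _ AB; rewrite mull; apply: (lsup_le hL) => _ [a Aa <-].
by rewrite mulr; apply: (lsup_le hL) => _ [b Bb <-]; apply: AB.
Qed.

Lemma mul_mono a a' b b' : a <= a' -> b <= b' -> mul a b <= mul a' b'.
Proof.
have lub2 (u v : L) : u <= v -> lsup [set u; v] = v.
  move=> uv; apply/eqP; rewrite eq_le; apply/andP; split.
    by apply: (lsup_le hL) => _ [->|->].
  by apply: le_lsup => //; right.
case: hmul => _ mull mulr _ aa' bb'; apply: (@le_trans _ _ (mul a' b)).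
  by rewrite -(lub2 _ _ aa') mull; apply: le_lsup => //; exists a => //; left.
by rewrite -(lub2 _ _ bb') mulr; apply: le_lsup => //; exists b => //; left.
Qed.

Lemma mul1l a : mul \top a = a. Proof. by case: hmul => _ _ _ []. Qed.

Lemma mul1r a : mul a \top = a. Proof. by case: hmul => _ _ _ []. Qed.

(** The unit is the top element, so [mul \bot a <= mul \bot \top = \bot]. *)
Lemma mul0l a : mul \bot a = \bot.
Proof.
by apply/eqP; rewrite eq_le le0x andbT -[leRHS]mul1r mul_mono ?lex1.
Qed.

Lemma mul0r a : mul a \bot = \bot.
Proof.
by apply/eqP; rewrite eq_le le0x andbT -[leRHS]mul1l mul_mono ?lex1.
Qed.

(** As [mul] preserves suprema in each variable, [mul a b] is the supremum of the products of
    approximations of its factors. *)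
Lemma totally_below_mul a b c : c ◁ mul a b ->
  exists a' b', [/\ a' ◁ a, b' ◁ b & c <= mul a' b'].
Proof.
move=> cab; have [|_ [a' [b' [a'a b'b ->]]] cab'] := cab
    [set e | exists a' b', [/\ a' ◁ a, b' ◁ b & e = mul a' b']].
  apply: (le_trans (mul_mono (le_lsup_totally_below hL a)
    (le_lsup_totally_below hL b))).
  by apply: mul_lub => a' b' a'a b'b; apply: le_lsup => //; exists a', b'.
by exists a', b'.
Qed.

(* Passing to a' ◁ a turns the supremum in R * Q into a single product.       *)
Lemma Larep_compP S1 S2 S3 (R : Larep L S1 S2) (Q : Larep L S2 S3) :
  approximable R -> approximable Q -> forall x z a,
  Larep_comp mul R Q x z a <-> forall z' a', z' ≪ z -> a' ◁ a ->
    exists y b c, [/\ R x y b, Q y z' c & a' <= mul b c].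
Proof.
move=> aR aQ x z a; split.
  pose U z' a' := exists y b c, [/\ R x y b, Q y z' c & a' <= mul b c].
  suff : Cl (cut (Larep_mul mul R Q) x) `<=`
      [set p : S3 *p L | forall y a, y ≪ p.1 -> a ◁ p.2 -> U y a].
    by move/(_ (z, a)).
  apply: smallest_sub; first exact: Scott_closed_approx.
  move=> [z1 a1] /= RQ z' a' z'z a'a.
  have [_ [y [b [c [Rb Qc ->]]]] a'bc] := totally_below_trans_le a'a RQ
    (lexx _).
  exists y, b, c; split => //; apply: approximable_mono Qc _ _ _ => //.
  exact: way_below_le (@cs_continuous S3) _ _ z'z.
move=> RQ C [sC RQC]; apply: Scott_closed_way_below => //.
  apply: RQC; rewrite /cut /Larep_mul /=; apply: le_lsup => //.
  (* At the bottom of [S3] every scalar is attained through the bottom of [S2], with the unit as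
     second factor. *)
  exists \bot, a, \top; rewrite mul1r; split => //.
  - exact: approximable_botl.
  - exact: approximable_botl.
move=> z' z'z; apply: RQC; rewrite /cut /Larep_mul /=.
apply: totally_below_lubP => // a' /(RQ _ _ z'z)[y [b [c [Rb Qc a'bc]]]].
by apply: le_trans a'bc _; apply: le_lsup => //; exists y, b, c.
Qed.

(** Splitting the approximation of the product leaves room to lower [y] to [y'] by [Q], and then [x]
    to [x'] by [R]. *)
Lemma approximable_comp S1 S2 S3 (R : Larep L S1 S2) (Q : Larep L S2 S3) :
  approximable R -> approximable Q -> approximable (Larep_comp mul R Q).
Proof.
move=> aR aQ x z a; split=> [/(Larep_compP aR aQ) RQ|RQ].
  move=> z' a' /(way_below_interpolation (@cs_continuous S3))[w z'w wz].
  move=> /(totally_below_interpolation hL)[e a'e ea].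
  have [y [b [c [Rb Qc ebc]]]] := RQ _ _ wz ea.
  have [b' [c' [b'b c'c a'bc]]] :=
    totally_below_mul (totally_below_trans_le a'e ebc).
  have [y' y'y Qc'] := (aQ _ _ _).1 Qc _ _ z'w c'c.
  have [x' x'x Rb'] := (aR _ _ _).1 Rb _ _ y'y b'b.
  exists x' => //; apply/(Larep_compP aR aQ) => v f vz' fa'.
  exists y', b', c'; split => //.
    apply: (approximable_mono aQ Qc') => //.
    exact: way_below_le (@cs_continuous S3) _ _ vz'.
  exact: le_trans (totally_below_le hL fa') a'bc.
apply/(Larep_compP aR aQ) => z' a'.
move=> /(way_below_interpolation (@cs_continuous S3))[w z'w wz].
move=> /(totally_below_interpolation hL)[e a'e ea].
have [x' x'x /(Larep_compP aR aQ) RQ'] := RQ _ _ wz ea.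
have [y [b [c [Rb Qc a'bc]]]] := RQ' _ _ z'w a'e.
exists y, b, c; split => //; apply: (approximable_mono aR Rb) => //.
exact: way_below_le (@cs_continuous S1) _ _ x'x.
Qed.

Lemma Larep_compA S1 S2 S3 S4
    (R : Larep L S1 S2) (Q : Larep L S2 S3) (T : Larep L S3 S4) :
  approximable R -> approximable Q -> approximable T ->
  Larep_comp mul R (Larep_comp mul Q T) = Larep_comp mul (Larep_comp mul R Q) T.
Proof.
move=> aR aQ aT; have mulA : associative mul by case: hmul.
have aQT := approximable_comp aQ aT; have aRQ := approximable_comp aR aQ.
have mQ y z z' c : Q y z c -> z' ≪ z -> Q y z' c.
  move=> Qc z'z; apply: (approximable_mono aQ Qc) => //.
  exact: way_below_le (@cs_continuous S3) _ _ z'z.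
have mT z w w' e : T z w e -> w' ≪ w -> T z w' e.
  move=> Te w'w; apply: (approximable_mono aT Te) => //.
  exact: way_below_le (@cs_continuous S4) _ _ w'w.
(* [U] is a bracket-free description by triple products; both bracketings are shown equivalent to
   it. *)
apply/predeq3P => x w a; pose U := forall w' a', w' ≪ w -> a' ◁ a ->
  exists y z b c e, [/\ R x y b, Q y z c, T z w' e & a' <= mul b (mul c e)].
apply: (@iff_trans _ U); last apply: iff_sym.
- split=> [/(Larep_compP aR aQT) RQT|RQT].
    move=> w' a' /(way_below_interpolation (@cs_continuous S4))[v w'v vw].
    move=> /(totally_below_interpolation hL)[f a'f fa].
    have [y [b [g [Rb QTg fbg]]]] := RQT _ _ vw fa.
    have [b' [g' [b'b g'g a'bg]]] :=
      totally_below_mul (totally_below_trans_le a'f fbg).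
    have [z [c [e [Qc Te g'ce]]]] := (Larep_compP aQ aT _ _ _).1 QTg _ _ w'v g'g.
    exists y, z, b, c, e; split => //; apply: le_trans a'bg _.
    by apply: mul_mono => //; apply: totally_below_le.
  apply/(Larep_compP aR aQT) => w' a' w'w /(RQT _ _ w'w).
  move=> [y [z [b [c [e [Rb Qc Te a'bce]]]]]].
  exists y, b, (mul c e); split => //; apply/(Larep_compP aQ aT) => v f vw' fce.
  exists z, c, e; split => //; last exact: totally_below_le.
  exact: mT vw'.
- split=> [/(Larep_compP aRQ aT) RQT|RQT].
    move=> w' a' /(way_below_interpolation (@cs_continuous S4))[v w'v vw].
    move=> /(totally_below_interpolation hL)[f a'f fa].
    have [z [g [e [RQg Te fge]]]] := RQT _ _ vw fa.
    have [g' [e' [g'g e'e a'ge]]] :=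
      totally_below_mul (totally_below_trans_le a'f fge).
    (* The composite of [R] and [Q] yields witnesses only strictly below [z], so [T] is first moved
       to some [z' ≪ z]. *)
    have [z' z'z Te'] := (aT _ _ _).1 Te _ _ w'v e'e.
    have [y [b [c [Rb Qc g'bc]]]] := (Larep_compP aR aQ _ _ _).1 RQg _ _ z'z g'g.
    exists y, z', b, c, e'; split => //; apply: le_trans a'ge _.
    by rewrite mulA; apply: mul_mono.
  apply/(Larep_compP aRQ aT) => w' a' w'w /(RQT _ _ w'w).
  move=> [y [z [b [c [e [Rb Qc Te a'bce]]]]]].
  exists z, (mul b c), e; rewrite -mulA; split => //.
  apply/(Larep_compP aR aQ) => v f vz fbc; exists y, b, c; split => //.
    exact: mQ vz.
  exact: totally_below_le.
Qed.

End Composition.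

End Approximation.

(** * The crisp category and its embedding *)

Section CrispApproximation.
Implicit Types S : contSemilat.

Definition crisp_approximable {S1 S2} (R : arep S1 S2) : Prop :=
  forall x y, R x y <-> forall y', y' ≪ y -> exists2 x', x' ≪ x & R x' y'.

Lemma SemPR_arrowP S1 S2 (R : arep S1 S2) :
  SemPR_arrow R <-> crisp_approximable R.
Proof.
split=> [[[mR cR] pR] x y|aR].
  split=> [Rxy y' y'y|Rx]; first exact: pR Rxy y'y.
  have [_ clR] := cR x; have [dy sy] := @cs_continuous S2 y.
  apply: clR dy sy => y' /Rx[x' x'x Rx']; apply: mR Rx' _ _ => //.
  exact: way_below_le (@cs_continuous S1) _ _ x'x.
split; last by move=> x y y' /aR; apply.
have mR x x' y y' : R x y -> x <= x' -> y' <= y -> R x' y'.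
  move=> /aR Rxy xx' y'y; apply/aR => z zy'.
  have [w wx Rw] := Rxy z (way_below_trans_le zy' y'y).
  by exists w => //; apply: way_below_trans_le xx'.
split=> // x; split=> [|D s DR dD sD].
  by exists \bot; apply/aR => y /not_way_below_bot.
apply/aR => y /(way_below_interpolation (@cs_continuous S2))[z yz zs].
have [w Dw zw] := zs D s dD sD (lexx s).
by have /aR := DR w Dw; apply; apply: way_below_trans_le zw.
Qed.

Lemma arep_compP S1 S2 S3 (R : arep S1 S2) (Q : arep S2 S3) :
  crisp_approximable Q -> forall x z,
  arep_comp R Q x z <-> forall z', z' ≪ z -> exists2 y, R x y & Q y z'.
Proof.
move=> /SemPR_arrowP[[mQ _] _] x z.
apply: Cl_lowerP (@cs_continuous S3) _ _ z => u v [y Rxy Qyv] uv.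
by exists y => //; apply: mQ Qyv _ uv.
Qed.

Lemma crisp_approximable_id S : crisp_approximable (@arep_id S).
Proof.
move=> x y; rewrite /arep_id; split=> [yx y' y'y|yx].
  have [z y'z zy] := way_below_interpolation (@cs_continuous S) y'y.
  exists z; first exact: way_below_trans_le yx.
  exact: way_below_le (@cs_continuous S) _ _ y'z.
apply: (supremums_least (@cs_continuous S y).2) => y' /yx[x' x'x y'x'].
exact: le_trans y'x' (way_below_le (@cs_continuous S) x'x).
Qed.

End CrispApproximation.

Section Embedding.
Context {d : Order.disp_t} {L : tbLatticeType d}.
Hypothesis hL : completely_distributive L.
Hypothesis hL01 : (\bot : L) <> \top.
Implicit Types S : contSemilat.

Lemma nonbot_below_top : exists2 a : L, a <> \bot & a ◁ \top.
Proof. by apply: totally_below_nonbot => // /esym. Qed.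

(** At a non-bottom scalar the embedded relation is [R] itself, and every non-bottom scalar has a
    non-bottom one totally below it, so witnesses transfer both ways. *)
Lemma Larep_embed_approximable S1 S2 (R : arep S1 S2) :
  approximable (@Larep_embed d L S1 S2 R) <-> crisp_approximable R.
Proof.
split=> aR x y; last first.
  move=> a; split=> [[/aR Rxy y' a' /Rxy[x' x'x Rx'] _|-> y' a' _]|Rxya].
  - by exists x' => //; left.
  - by move=> /totally_below_bot.
  have [->|/(totally_below_nonbot hL)[b b0 ba]] := pselect (a = \bot).
    by right.
  left; apply/aR => y' y'y.
  by have [x' x'x [Rx'|//]] := Rxya _ _ y'y ba; exists x'.
have [e e0 e1] := nonbot_below_top.
split=> [Rxy y' y'y|Rxy].
  have /aR/(_ _ _ y'y e1)[x' x'x [Rx'|//]] : Larep_embed R x y (\top : L) by left.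
  by exists x'.
have /aR[//|/esym //] : forall y' a', y' ≪ y -> a' ◁ (\top : L) ->
    exists2 x', x' ≪ x & Larep_embed R x' y' a'.
by move=> y' a' /Rxy[x' x'x Rx'] _; exists x' => //; left.
Qed.

Lemma Larep_embed_inj S1 S2 : injective (@Larep_embed d L S1 S2).
Proof.
move=> R Q RQ; apply/predeq2P => x y.
have E (T : arep S1 S2) : T x y <-> Larep_embed T x y (\top : L).
  by split=> [|[//|/esym]]; [left|].
by rewrite (E R) (E Q) RQ.
Qed.

Variable mul : L -> L -> L.
Hypothesis hmul : unital_quantale mul.

(** Crisp witnesses carry the scalar [\top], with [mul \top \top = \top]. Conversely, a non-bottom
    product has non-bottom factors, so its two witnesses are crisp. *)
Lemma Larep_embed_comp S1 S2 S3 (R : arep S1 S2) (Q : arep S2 S3) :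
  crisp_approximable R -> crisp_approximable Q ->
  Larep_embed (arep_comp R Q) =
  Larep_comp mul (Larep_embed R) (Larep_embed Q) :> Larep L S1 S3.
Proof.
move=> aR aQ; have aR' := (Larep_embed_approximable R).2 aR.
have aQ' := (Larep_embed_approximable Q).2 aQ.
apply/predeq3P => x z a; split=> [[/(arep_compP _ aQ) RQ|->]|].
- apply/(Larep_compP hL hmul aR' aQ') => z' a' /RQ[y Rxy Qyz'] _.
  exists y, \top, \top; rewrite (mul1l hmul) lex1.
  by split => //; left.
- by apply/(Larep_compP hL hmul aR' aQ') => z' a' _ /totally_below_bot.
move=> /(Larep_compP hL hmul aR' aQ') RQ.
have [->|/(totally_below_nonbot hL)[b b0 ba]] := pselect (a = \bot).
  by right.
left; apply/(arep_compP _ aQ) => z' /RQ/(_ ba)[y [c [e [Rc Qe bce]]]].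
have nb : mul c e <> \bot.
  by move=> ce0; apply/b0/eqP; rewrite eq_le le0x -ce0 bce.
exists y.
  by case: Rc => // c0; case: nb; rewrite c0 (mul0l hL hmul).
by case: Qe => // e0; case: nb; rewrite e0 (mul0r hL hmul).
Qed.

(** Composing with the identity gains nothing because [mul b c <= c], and loses nothing because the
    identity relates [x] to itself with scalar [\top]. *)
Lemma Larep_comp1l S1 S2 (R : Larep L S1 S2) : approximable R ->
  Larep_comp mul (Larep_embed (@arep_id S1)) R = R.
Proof.
move=> aR; have aE := (Larep_embed_approximable _).2 (@crisp_approximable_id S1).
apply/predeq3P => x z a; split=> [/(Larep_compP hL hmul aE aR) Rx|Rxza].
  apply: (approximable_closed hL aR) => z' a' z'z /(Rx _ _ z'z).
  move=> [y [b [c [[yx|->] Rc a'bc]]]].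
    apply: (approximable_mono aR Rc) => //; apply: le_trans a'bc _.
    by rewrite -[leRHS](mul1l hmul) (mul_mono hL hmul) ?lex1.
  move: a'bc; rewrite (mul0l hL hmul) => a'0.
  exact: (approximable_mono aR (approximable_botr aR x z')).
apply/(Larep_compP hL hmul aE aR) => z' a' z'z a'a.
exists x, \top, a'; rewrite (mul1l hmul); split => //; first by left; exact: lexx.
apply: (approximable_mono aR Rxza) => //; last exact: totally_below_le.
exact: way_below_le (@cs_continuous S2) _ _ z'z.
Qed.

Lemma Larep_comp1r S1 S2 (R : Larep L S1 S2) : approximable R ->
  Larep_comp mul R (Larep_embed (@arep_id S2)) = R.
Proof.
move=> aR; have aE := (Larep_embed_approximable _).2 (@crisp_approximable_id S2).
apply/predeq3P => x z a; split=> [/(Larep_compP hL hmul aR aE) Rx|Rxza].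
  apply: (approximable_closed hL aR) => z' a' z'z /(Rx _ _ z'z).
  move=> [y [b [c [Rb [z'y|->] a'bc]]]].
    apply: (approximable_mono aR Rb) => //; apply: le_trans a'bc _.
    by rewrite -[leRHS](mul1r hmul) (mul_mono hL hmul) ?lex1.
  move: a'bc; rewrite (mul0r hL hmul) => a'0.
  exact: (approximable_mono aR (approximable_botr aR x z')).
apply/(Larep_compP hL hmul aR aE) => z' a' z'z a'a.
exists z', a', \top; rewrite (mul1r hmul); split => //; last by left; exact: lexx.
apply: (approximable_mono aR Rxza) => //; last exact: totally_below_le.
exact: way_below_le (@cs_continuous S2) _ _ z'z.
Qed.

End Embedding.

(** * Assembling the two categories and the embedding *)

Theorem proposition4p0p4
  (d : Order.disp_t) (L : tbLatticeType d)
  (hL : completely_distributive L) (hL01 : (\bot)%O <> (\top)%O :> L)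
  (mul : L -> L -> L) (hmul : unital_quantale mul)
  (hat : contSemilat -> contSemilat)
  (P : forall S : contSemilat, S -> hat S -> bool)
  (hP : forall S : contSemilat, compatibility (P S))
  (hPsep : forall S : contSemilat, separating (P S))
  (hPdual : forall S : contSemilat, Lawson_dual (P S)) :
  is_category (@SemPR_arrow) (@arep_comp) arep_id /\
  exists idL : forall S : contSemilat, Larep L S S,
    is_category (@SemPRL_arrow d L hat P) (@Larep_comp d L mul) idL /\
    is_subcategory_embedding
      (@SemPR_arrow) (@arep_comp) arep_id
      (@SemPRL_arrow d L hat P) (@Larep_comp d L mul) idL
      (@Larep_embed d L).
Proof.
have arrP S1 S2 (R : Larep L S1 S2) : SemPRL_arrow P R <-> approximable R.
  exact: SemPRL_arrowP.
have embP := Larep_embed_approximable hL hL01.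
have embI := Larep_embed_inj hL01.
have embM := Larep_embed_comp hL hL01 hmul.
have id_arr S : approximable (@Larep_embed d L S S (@arep_id S)).
  exact/embP/crisp_approximable_id.
split.
  split.
  - by move=> S; apply/SemPR_arrowP/crisp_approximable_id.
  - move=> S1 S2 S3 R Q /SemPR_arrowP aR /SemPR_arrowP aQ.
    (* The embedding reflects arrows, so closure is checked on the fuzzy composite of the images. *)
    apply/SemPR_arrowP/embP; rewrite embM //.
    by apply: approximable_comp => //; apply/embP.
  - move=> S1 S2 S3 S4 R Q T /SemPR_arrowP aR /SemPR_arrowP aQ /SemPR_arrowP aT.
    have aRQ : crisp_approximable (arep_comp R Q).
      by apply/embP; rewrite embM //; apply: approximable_comp => //; apply/embP.
    have aQT : crisp_approximable (arep_comp Q T).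
      by apply/embP; rewrite embM //; apply: approximable_comp => //; apply/embP.
    apply: embI; rewrite !embM //.
    by apply: Larep_compA => //; apply/embP.
  - move=> S1 S2 R /SemPR_arrowP aR; apply: embI; rewrite embM //.
      by apply: Larep_comp1l => //; apply/embP.
    exact: crisp_approximable_id.
  - move=> S1 S2 R /SemPR_arrowP aR; apply: embI; rewrite embM //.
      by apply: Larep_comp1r => //; apply/embP.
    exact: crisp_approximable_id.
(* Fuzzy identities are the images of the crisp ones, so the functor preserves them by
   definition. *)
exists (fun S => Larep_embed (@arep_id S)); split.
  split.
  - by move=> S; apply/arrP.
  - move=> S1 S2 S3 R Q /arrP aR /arrP aQ; apply/arrP.
    exact: approximable_comp.
  - move=> S1 S2 S3 S4 R Q T /arrP aR /arrP aQ /arrP aT.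
    exact: Larep_compA.
  - by move=> S1 S2 R /arrP aR; apply: Larep_comp1l.
  - by move=> S1 S2 R /arrP aR; apply: Larep_comp1r.
split=> //.
- by move=> S1 S2 R /SemPR_arrowP aR; apply/arrP/embP.
- by move=> S1 S2 R Q _ _ /embI.
- by move=> S1 S2 S3 R Q /SemPR_arrowP aR /SemPR_arrowP aQ; apply: embM.
Qed.
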